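(* Let $R$ be a unitary ring with involution $*$ and let $a\in R$. Then $a$ is weak group invertible if and only if $a$ is Drazin invertible and there exists an idempotent $g\in R$ with $g\in aa^{D}R$ such that $(a^{D})^{*}ag=(a^{D})^{*}a$.
   Context: $R$ is an associative ring with identity $1$ equipped with an involution, i.e. a map $a\mapsto a^{*}$ with $(a+b)^{*}=a^{*}+b^{*}$, $(ab)^{*}=b^{*}a^{*}$, $(a^{*})^{*}=a$ for all $a,b\in R$. $\mathbb{N}^{+}$ is the set of positive integers. For $a\in R$, $aR=\{ax: x\in R\}$. Drazin inverse: $a\in R$ is Drazin invertible if there exist $x\in R$ and $k\in\mathbb{N}^{+}$ with $xa^{k+1}=a^{k}$, $xax=x$, $xa=ax$; such $x$ is unique and denoted $a^{D}$. Weak group inverse: for $a\in R$, an element $x\in R$ is called a weak group inverse of $a$ if there exists $k\in\mathbb{N}^{+}$ such that $xa^{k+1}=a^{k}$, $ax^{2}=x$, and $(a^{k})^{*}a^{2}x=(a^{k})^{*}a$. It need not be unique; $a$ is weak group invertible if it has at least one weak group inverse. *)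

(* Defs.v *)
From mathcomp Require Import all_boot all_algebra.

Set Implicit Arguments.
Unset Strict Implicit.
Unset Printing Implicit Defensive.

Import GRing.Theory.
Local Open Scope ring_scope.

(* Not the InvolutiveRMorphism of mathcomp's sesquilinear.v: that structure is
   multiplicative, whereas an involution of a ring reverses products. *)
Definition ring_involution (R : pzRingType) (star : R -> R) : Prop :=
  [/\ forall a b, star (a + b) = star a + star b,
      forall a b, star (a * b) = star b * star a
    & forall a, star (star a) = a].

Definition idempotent_elt (R : pzRingType) (g : R) : Prop := g * g = g.

Definition in_right_ideal (R : pzRingType) (a y : R) : Prop :=
  exists x, y = a * x.

Definition drazin_inverse (R : pzRingType) (a x : R) : Prop :=
  exists k : nat,
    [/\ (0 < k)%N, x * a ^+ k.+1 = a ^+ k, x * a * x = x & x * a = a * x].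

Definition weak_group_inverse (R : pzRingType) (star : R -> R) (a x : R) : Prop :=
  exists k : nat,
    [/\ (0 < k)%N, x * a ^+ k.+1 = a ^+ k, a * x ^+ 2 = x
      & star (a ^+ k) * a ^+ 2 * x = star (a ^+ k) * a].

Definition weak_group_invertible (R : pzRingType) (star : R -> R) (a : R) : Prop :=
  exists x, weak_group_inverse star a x.

(* Hence quantifying existentially over a Drazin inverse of a both asserts that
   a is Drazin invertible and names the element written a^D. *)
Lemma drazin_inverse_unique (R : pzRingType) (a x y : R) :
  drazin_inverse a x -> drazin_inverse a y -> x = y.
Proof.
have powS z k n : z * a ^+ k.+1 = a ^+ k -> (k <= n)%N ->
    z * a ^+ n.+1 = a ^+ n.
  move=> zk /subnKC <-; move: (n - k)%N => m.
  by rewrite -addSn exprD mulrA zk -exprD.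
have outer z n : z * a * z = z -> GRing.comm z a -> z ^+ n.+1 * a ^+ n = z.
  move=> zaz za; elim: n => [|n IHn]; first by rewrite expr1 mulr1.
  rewrite exprS [a ^+ n.+1]exprSr mulrA -(mulrA z) IHn -mulrA.
  by rewrite za mulrA.
move=> [k [_ xk xax xa]] [l [_ yl yay ya]].
pose n := maxn k l.
have {xk} xn : x * a ^+ n.+1 = a ^+ n by apply: powS xk (leq_maxl k l).
have {yl} yn : y * a ^+ n.+1 = a ^+ n by apply: powS yl (leq_maxr k l).
have yC m : GRing.comm y (a ^+ m) by apply: commrX.
have -> : x = x * a * y.
  have xE := outer x n xax xa.
  by rewrite -[LHS]xE -yn yC [a ^+ n.+1]exprSr !mulrA xE.
have yE : a ^+ n * y ^+ n.+1 = y.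
  by rewrite -[RHS](outer y n yay ya); apply: commrX; apply: commr_sym.
by rewrite -[RHS]yE -xn exprS -!mulrA yE.
Qed.

(* Main.v *)
Require Import Defs.
From mathcomp Require Import all_boot all_algebra.
Local Open Scope ring_scope.

Import GRing.Theory.

(** Write d for the Drazin inverse of a and p = a d for its spectral idempotent.
    The equations x a^(k+1) = a^k and a x^2 = x say that x inverts a on the
    right ideal generated by a^k, which is p R; they alone produce
    d = x^(k+1) a^k ([drazin_of_core]).  Since d = a^k d^(k+1) and a^k = d a^(k+1)
    are right multiples of each other, star (a^k) and star d are left multiples
    of each other, and star (a^k) a (1 - g) = 0 is the same condition as
    star d a (1 - g) = 0.  So g = a x, which lies in a^k R, is the required
    idempotent.

    Conversely, one expects x = d g.  This can fail: when star d a = 0, the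
    element g = 0 is admissible, and d g = 0 does not invert a on p R unless
    p = 0.  The remedy is to enlarge g to h = g + (1 - g) p.  It stays in p R,
    it satisfies h p = p, and 1 - h = (1 - g) (1 - p), so star d a (1 - h) vanishes as soon
    as star d a (1 - g) does.  Then x = d h is a weak group inverse
    ([weak_group_of_projection]). *)

Lemma expr_mul_expr_absorb (R : pzRingType) (a x : R) n :
  a * x ^+ 2 = x -> a ^+ n * x ^+ n.+1 = x.
Proof.
move=> ax; elim: n => [|n IHn]; first by rewrite mul1r expr1.
have axS : a * x ^+ n.+2 = x ^+ n.+1.
  by rewrite -[in LHS]add2n exprD mulrA ax -exprS.
by rewrite [a ^+ _]exprSr -mulrA axS.
Qed.

Lemma expr_mul_expr_stable (R : pzRingType) (a x : R) k n :
  x * a ^+ k.+1 = a ^+ k -> x ^+ n * a ^+ (n + k) = a ^+ k.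
Proof.
move=> xa; elim: n => [|n IHn]; first by rewrite mul1r.
by rewrite exprSr -mulrA addSnnS addnC exprD [x * _]mulrA xa -exprD addnC IHn.
Qed.

(** Both a d and d a equal x^k a^k, d a because x a^(k+1) = a^k, and a d
    because a x^(k+1) = x^k, which follows from a x^2 = x only for positive k. *)
Lemma drazin_of_core (R : pzRingType) (a x : R) k :
  (0 < k)%N -> x * a ^+ k.+1 = a ^+ k -> a * x ^+ 2 = x ->
  let d := x ^+ k.+1 * a ^+ k in
  [/\ d * a ^+ k.+1 = a ^+ k, d * a * d = d & d * a = a * d].
Proof.
move=> k0 xa ax /=.
have da : x ^+ k.+1 * a ^+ k * a = x ^+ k * a ^+ k.
  by rewrite -mulrA -exprSr exprSr -mulrA xa.
split.
- by rewrite [a ^+ k.+1]exprS mulrA da -mulrA -exprD expr_mul_expr_stable.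
- by rewrite da mulrA -(mulrA _ (a ^+ k)) expr_mul_expr_absorb // -exprSr.
- rewrite da mulrA; congr (_ * _); case: k k0 {xa da} => // k _.
  by rewrite -[k.+2]add2n exprD mulrA ax -exprS.
Qed.

Lemma expr_mul_drazin_expr (R : pzRingType) (a d : R) n :
  d * a * d = d -> d * a = a * d -> a ^+ n * d ^+ n.+1 = d.
Proof.
by move=> dad da; apply: expr_mul_expr_absorb; rewrite expr2 mulrA -da.
Qed.

(** The equation h p = p makes d h agree with d on p R, hence invert a there,
    and p h = h makes a (d h) equal to h.  The condition on star d a passes to
    star (a^k) a because a^k is a right multiple of d. *)
Lemma weak_group_of_projection (R : pzRingType) (star : R -> R) (a d h : R) :
  ring_involution star -> drazin_inverse a d ->
  a * d * h = h -> h * (a * d) = a * d -> star d * a * h = star d * a ->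
  weak_group_inverse star a (d * h).
Proof.
move=> [_ starM _] [k [k0 dk dad da]] ph hp sh; exists k; split=> //.
- have pa : a * d * a ^+ k.+1 = a ^+ k.+1 by rewrite -mulrA dk -exprS.
  by rewrite -{1}pa -mulrA (mulrA h) hp pa dk.
- have pd : a * d * d = d by rewrite -da.
  by rewrite expr2 !mulrA ph -{1}pd mulrA hp pd.
- by rewrite -{1 2}dk starM expr2 -!mulrA (mulrA a d) ph [star d * _]mulrA sh.
Qed.

Theorem corollary3p2 (R : pzRingType) (star : R -> R)
    (star_inv : ring_involution star) (a : R) :
  weak_group_invertible star a <->
  exists aD : R, drazin_inverse a aD /\
    exists g : R, [/\ idempotent_elt g,
                      in_right_ideal (a * aD) g
                    & star aD * a * g = star aD * a].
Proof.
split=> [[x [k [k0 xa ax sx]]]|[d [dP [g [_ [y gE] sg]]]]].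
- pose d := x ^+ k.+1 * a ^+ k.
  have [dk dad da] : [/\ d * a ^+ k.+1 = a ^+ k, d * a * d = d & d * a = a * d].
    exact: drazin_of_core.
  exists d; split; first by exists k.
  have xE : a ^+ k * x ^+ k.+1 = x by apply: expr_mul_expr_absorb.
  have xax : x * a * x = x by rewrite -{2}xE mulrA -(mulrA x) -exprS xa.
  exists (a * x); split.
  + by rewrite /idempotent_elt -mulrA (mulrA x) xax.
  + by exists (a ^+ k.+1 * x ^+ k.+1); rewrite -mulrA (mulrA d) dk xE.
  + have [_ starM _] := star_inv.
    rewrite -(expr_mul_drazin_expr _ a d k dad da) starM -!mulrA; congr (_ * _).
    by rewrite -sx expr2 !mulrA.
- have [k [_ _ dad da]] := dP.
  set p := a * d in gE.
  have pp : p * p = p by rewrite /p -mulrA (mulrA d) dad.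
  have pg : p * g = g by rewrite gE mulrA pp.
  (* The second factor is g + (1 - g) p. *)
  exists (d * (g + (p - g * p))); apply: weak_group_of_projection => //.
  + by rewrite -/p mulrDr mulrBr (mulrA p g) pg pp.
  + by rewrite -/p mulrDl mulrBl -(mulrA g) pp addrC subrK.
  + by rewrite mulrDr mulrBr (mulrA _ g p) sg subrr addr0.
Qed.
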